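(* Let $K$ be a field, $x=(x_1,\dots,x_n)$ an $n$-tuple of variables, and let $p, q \in K[x]$ be not both constant, such that $\gcd\{p,q\} = 1$. Consider the statements: (1) $p$ and $q$ are algebraically dependent over $K$ and $K(p/q)$ is algebraically closed in $K(x)$; (2) $K(p/q) \cap K[x] \ne K$; (3) there are $\lambda, \mu \in K$ such that $\lambda p + \mu q = 1$; (4) $K(p/q) = K(p,q)$. Then $(1) \Rightarrow (2) \Rightarrow (3) \Rightarrow (4)$.
   Context: $K(x)$ is the fraction field of $K[x]=K[x_1,\dots,x_n]$. Constant means lying in $K$. (Under the hypotheses $q\neq 0$.) *)

(* Defs.v *)
From HB Require Import structures.
From mathcomp Require Import all_boot all_order all_algebra.
From mathcomp Require Import mpoly.
From mathcomp Require Import classical_sets.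

Set Implicit Arguments.
Unset Strict Implicit.
Unset Printing Implicit Defensive.

Import GRing.Theory.

Local Open Scope ring_scope.
Local Open Scope classical_set_scope.

Notation "x %:F" := (tofrac x) : ring_scope.

(* Subfields of K(x) are not decidable in general and K(x) is not a finite
   extension, so they are taken as classical sets rather than as {subfield _}.
   Membership of a set is boolean through the classical predType instance. *)
Section Subfields.
Variable L : fieldType.

Definition is_subfield (E : set L) : Prop := divring_closed (mem E).

Definition adjoin (E S : set L) : set L := smallest is_subfield (E `|` S).

Definition algebraic_over (E : set L) (z : L) : Prop :=
  exists f : {poly L}, [/\ f != 0, f \is a polyOver (mem E) & root f z].

Definition alg_closed_in (E : set L) : Prop :=
  forall z : L, algebraic_over E z -> E z.

End Subfields.

Section Polynomials.
Variables (K : fieldType) (n : nat).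
Implicit Types p q d : {mpoly K[n]}.

Definition is_constant p : Prop := exists c : K, p = c%:MP.

Definition mdivides d p : Prop := exists e : {mpoly K[n]}, p = d * e.

(* g is a greatest common divisor of p and q for the divisibility order;
   gcds are determined only up to a nonzero constant. *)
Definition is_gcd g p q : Prop :=
  [/\ mdivides g p, mdivides g q &
      forall d, mdivides d p -> mdivides d q -> mdivides d g].

Definition alg_dependent p q : Prop :=
  exists F : {mpoly K[2]}, F != 0 /\ F \mPo [tuple p; q] = 0.

(* The copies of K[x] and K inside K(x). *)
Definition polynomials : set {fraction {mpoly K[n]}} :=
  [set p%:F | p in [set: {mpoly K[n]}]].

Definition constants : set {fraction {mpoly K[n]}} :=
  [set (c%:MP_[n])%:F | c in [set: K]].

End Polynomials.

Arguments polynomials K n : clear implicits.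
Arguments constants K n : clear implicits.

(* Main.v *)
(* Write t = p/q.  An element of K(t) is f(t)/g(t), and clearing denominators
   turns f(t), g(t) into the values at (p, q) of homogeneous forms of degree m.
   Comparing coefficients at the largest monomial M of p and q, a form whose
   value at (p, q) has no M^m coefficient vanishes at the pair (p_M, q_M) of K^2,
   so it has a linear factor over K.  Applied to a form vanishing at (p, q) this
   shows that t is transcendental, which gives (1) => (2): q is algebraic over
   K(t).  For (2) => (3), if f(t)/g(t) is a polynomial with f, g coprime, then the
   denominator form divides a power of q, and by unique factorization in K[x] its
   value at (p, q) is a nonzero constant; its linear factor is then a constant
   too, i.e. l p + m q = 1. *)
Require Import Defs.
From HB Require Import structures.
From mathcomp Require Import all_boot all_order all_algebra.
From mathcomp Require Import mpoly.
From mathcomp Require Import zify.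
From mathcomp Require Import boolp classical_sets.

Set Implicit Arguments.
Unset Strict Implicit.
Unset Printing Implicit Defensive.

Import Order.TTheory GRing.Theory.
Local Open Scope ring_scope.
Local Open Scope classical_set_scope.

(** * Unique factorization in polynomial rings *)

Section Divisibility.
Context {R : idomainType}.
Implicit Types a b c d : R.

Definition divides a b : Prop := exists c, b = a * c.

Definition irreducible_elt a : Prop :=
  [/\ a != 0, a \isn't a GRing.unit &
      forall b c, a = b * c -> b \is a GRing.unit \/ c \is a GRing.unit].

Definition prime_elt a : Prop :=
  [/\ a != 0, a \isn't a GRing.unit &
      forall b c, divides a (b * c) -> divides a b \/ divides a c].

(** A closure under products instead of a list of factors, so that inductions follow the product
    structure; the factors are prime, not merely irreducible. *)
Inductive prime_product : R -> Prop :=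
| prime_product_unit u : u \is a GRing.unit -> prime_product u
| prime_product_prime a : prime_elt a -> prime_product a
| prime_product_mul a b :
    prime_product a -> prime_product b -> prime_product (a * b).

Lemma divides_mulr a b c : divides a b -> divides a (b * c).
Proof. by move=> [x ->]; exists (x * c); rewrite mulrA. Qed.

Lemma divides_mull a b c : divides a b -> divides a (c * b).
Proof. by rewrite mulrC; apply: divides_mulr. Qed.

Lemma divides_add a b c : divides a b -> divides a c -> divides a (b + c).
Proof. by move=> [x ->] [y ->]; exists (x + y); rewrite mulrDr. Qed.

Lemma divides_sub a b c : divides a b -> divides a c -> divides a (b - c).
Proof. by move=> [x ->] [y ->]; exists (x - y); rewrite mulrBr. Qed.

Lemma divides_sum (I : Type) (s : seq I) (P : pred I) (F : I -> R) a :
  (forall i, P i -> divides a (F i)) -> divides a (\sum_(i <- s | P i) F i).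
Proof.
move=> aF; elim/big_ind: _ => //; first by exists 0; rewrite mulr0.
by move=> b c; apply: divides_add.
Qed.

Lemma divides_unit a b : b \is a GRing.unit -> divides a b -> a \is a GRing.unit.
Proof. by move=> + [c def_b]; rewrite def_b unitrM => /andP[]. Qed.

Lemma divides_mulUr a b u : u \is a GRing.unit -> divides a (u * b) -> divides a b.
Proof. by move=> uU [c ubE]; exists (u^-1 * c); rewrite mulrCA -ubE mulKr. Qed.

Lemma prime_dividesX a b k : prime_elt a -> divides a (b ^+ k) -> divides a b.
Proof.
case=> _ aNU aP; elim: k => [/(divides_unit (unitr1 R))|k IHk].
  by rewrite (negPf aNU).
by rewrite exprS => /aP[].
Qed.

Lemma prime_product_divisor c :
  prime_product c -> c \is a GRing.unit \/ exists2 a, prime_elt a & divides a c.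
Proof.
elim=> [u uU|a pa|a b _ IHa _ IHb]; first by left.
  by right; exists a => //; exists 1; rewrite mulr1.
case: IHa => [aU|[x px xa]]; last by right; exists x => //; apply: divides_mulr.
case: IHb => [bU|[x px xb]]; last by right; exists x => //; apply: divides_mull.
by left; rewrite unitrM aU.
Qed.

End Divisibility.

(** * Gauss's lemma and primes of R[X] *)

Section PolynomialPrimes.
Variable R : idomainType.
Implicit Types (a c : R) (f g h d s : {poly R}).

Lemma divides_polyMX a f : divides a%:P (f * 'X) -> divides a%:P f.
Proof.
case=> h fX; have [a0|a0] := eqVneq a 0.
  exists 0; move: fX; rewrite a0 polyC0 !mul0r => /eqP.
  by rewrite mulf_eq0 polyX_eq0 orbF => /eqP.
have : root h 0.
  have /eqP := congr1 (horner^~ 0) fX; rewrite !hornerE.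
  by rewrite eq_sym mulf_eq0 (negPf a0).
case/factor_theorem=> h'; rewrite subr0 => hE.
by exists h'; apply: (mulIf (negbT (polyX_eq0 R))); rewrite fX hE mulrA.
Qed.

(** Gauss's lemma, by induction on both factors: [a] divides the product of the constant terms,
    hence one of them; drop that term and divide by ['X]. *)
Lemma prime_polyC a f g :
  prime_elt a -> divides a%:P (f * g) -> divides a%:P f \/ divides a%:P g.
Proof.
case=> [a0 _ aP]; elim/poly_ind: f g => [g _|f c IHf].
  by left; exists 0; rewrite mulr0.
elim/poly_ind=> [_|g d IHg dvd_fg]; first by right; exists 0; rewrite mulr0.
have divC b : divides a b -> divides a%:P b%:P.
  by case=> e ->; exists e%:P; rewrite polyCM.
have [|/divC ac|/divC ad] := aP c d.
- case: dvd_fg => h /(congr1 (horner^~ 0)); rewrite !(hornerE, mulr0, add0r).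
  by move=> ->; exists h.[0].
- have /IHf[|] : divides a%:P (f * (g * 'X + d%:P)).
  + apply: divides_polyMX; rewrite mulrAC.
    rewrite -[f * 'X](addrK c%:P) mulrBl; apply: divides_sub => //.
    exact: divides_mulr.
  + by left; apply: divides_add => //; apply: divides_mulr.
  + by right.
- have /IHg[|] : divides a%:P ((f * 'X + c%:P) * g).
  + apply: divides_polyMX; rewrite -mulrA.
    rewrite -[g * 'X](addrK d%:P) mulrBr; apply: divides_sub => //.
    exact: divides_mull.
  + by left.
  + by right; apply: divides_add => //; apply: divides_mulr.
Qed.

(** Gauss's lemma settles a single prime constant; for [a * b], split [a] first, cancel it, and
    split [b] over the remaining cofactors. This does the work of contents and primitive parts. *)
Lemma prime_product_primal c g d s :
  prime_product c -> c%:P * g = d * s ->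
  exists c1 c2 d' s', [/\ c = c1 * c2, d = c1%:P * d' & s = c2%:P * s'].
Proof.
move=> pc; elim: pc g d s => {c} [u uU|a pa|a b _ IHa _ IHb] g d s E.
- exists u, 1, (u^-1%:P * d), s.
  by rewrite mulr1 mul1r mulrA -polyCM divrr // mul1r.
- have [[d' ->]|[s' ->]] : divides a%:P d \/ divides a%:P s.
  + by apply: prime_polyC => //; exists g.
  + by exists a, 1, d', s; rewrite mulr1 mul1r.
  + by exists 1, a, d, s'; rewrite !mul1r.
have [|a1 [a2 [d1 [s1 [aE dE sE]]]]] := IHa (b%:P * g) d s.
  by rewrite mulrA -polyCM.
(* Cancelling [a] requires it to be nonzero; if it is zero, then [d] or [s] vanishes and the
   splitting is trivial. *)
have [a0|a0] := eqVneq a 0.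
  move: aE => /esym/eqP; rewrite a0 mulf_eq0 => /orP[/eqP a10|/eqP a20].
    by exists 0, 1, 0, s; rewrite mul0r mul1r dE a10 polyC0 !mul0r.
  by exists 1, 0, d, 0; rewrite mulr0 mul1r sE a20 polyC0 !mul0r.
have /IHb[b1 [b2 [d2 [s2 [-> d1E s1E]]]]] : b%:P * g = d1 * s1.
  have aP0 : a%:P != 0 by rewrite polyC_eq0.
  by apply: (mulfI aP0); rewrite mulrA -polyCM E dE sE aE polyCM mulrACA.
exists (a1 * b1), (a2 * b2), d2, s2.
by split; [rewrite aE mulrACA | rewrite dE d1E polyCM mulrA
          | rewrite sE s1E polyCM mulrA].
Qed.

Hypothesis factR : forall c : R, c != 0 -> prime_product c.

(* With d = a f + b g a pseudo-gcd of f and g, nonzero constants c, c' satisfy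
   c f = s d and c' g = t d; the primality of constants removes c and c', so that
   either f is associate to d and divides g, or d is associate to a constant and
   f divides d h. *)
Lemma irreducible_prime_poly f : irreducible_elt f -> prime_elt f.
Proof.
move=> [f0 fNU fI]; split=> // g h fgh.
have polyCU c : c%:P \is a GRing.unit -> c \is a GRing.unit.
  by rewrite poly_unitE coefC size_polyC /= => /andP[].
have [sz1|sz1] := leqP (size f) 1%N.
  have fE := size1_polyC sz1; set c := f`_0 in fE.
  have c0 : c != 0 by rewrite -(polyC_eq0 c) -fE.
  case: fgh => k ghE; rewrite fE in ghE *.
  have [c1 [c2 [g' [h' [cE gE hE]]]]] := prime_product_primal (factR c0) (esym ghE).
  have [|c1U|c2U] := fI c1%:P c2%:P; first by rewrite fE cE polyCM.
  - right; apply: (divides_mulUr c1U); rewrite hE mulrA -polyCM -cE.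
    by exists h'.
  - left; apply: (divides_mulUr c2U); rewrite gE mulrCA mulrA -polyCM -cE.
    by exists g'.
have szU u v : v \is a GRing.unit -> f = u%:P * v -> False.
  rewrite poly_unitE => /andP[/eqP szv _] fE; move: sz1.
  by rewrite fE ltnNge mul_polyC (leq_trans (size_scale_leq _ _)) ?szv.
(* Split [c] along [f * u]: as [f] is irreducible of positive degree, the constant split off from
   [f] is a unit, and the rest of [c] cancels. *)
have cancelC c k : c != 0 -> divides f (c%:P * k) -> divides f k.
  move=> c0 [u ckE].
  have [c1 [c2 [f' [u' [cE fE uE]]]]] := prime_product_primal (factR c0) ckE.
  have [//|c1U|f'U] := fI c1%:P f'; last by case: (szU c1 f').
  apply: (divides_mulUr c1U).
  have cP0 : c2%:P != 0.
    by rewrite polyC_eq0; apply: contraNneq c0 => c20; rewrite cE c20 mulr0.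
  exists u'; apply: (mulfI cP0).
  by rewrite mulrCA mulrA -polyCM -cE ckE uE mulrCA.
have [[a b] /= ] := Bezoutp f g; set d := a * f + b * g => dgcd.
have : d %| f by rewrite (eqp_dvdl _ dgcd) dvdp_gcdl.
have : d %| g by rewrite (eqp_dvdl _ dgcd) dvdp_gcdr.
case/Pdiv.Idomain.dvdpP => -[c' t] /= c'0 gE.
case/Pdiv.Idomain.dvdpP => -[c s] /= c0 fE.
rewrite -!mul_polyC in fE gE.
have [c1 [c2 [s' [d' [cE sE dE]]]]] := prime_product_primal (factR c0) fE.
have c20 : c2 != 0 by apply: contraNneq c0 => c20; rewrite cE c20 mulr0.
have fE' : f = s' * d'.
  have cP0 : c%:P != 0 by rewrite polyC_eq0.
  by apply: (mulfI cP0); rewrite fE sE dE cE polyCM mulrACA.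
have [//|s'U|d'U] := fI s' d'.
  left; apply: (cancelC c') => //; rewrite gE dE mulrA; apply: divides_mull.
  by exists s'^-1; rewrite fE' mulrC mulKr.
right; apply: (cancelC c2) => //; apply: (divides_mulUr d'U).
rewrite mulrCA mulrA -dE /d mulrDl -mulrA; apply: divides_add.
  by apply: divides_mull; exists h.
by rewrite -mulrA; apply: divides_mull.
Qed.

End PolynomialPrimes.

(** * Transport along a ring isomorphism *)

Section Transfer.
Variables (A B : idomainType) (phi : {rmorphism A -> B}) (psi : B -> A).
Hypotheses (phiK : cancel phi psi) (psiK : cancel psi phi).

Lemma divides_cancel a b : divides (phi a) (phi b) -> divides a b.
Proof.
case=> c E; exists (psi c); apply: (can_inj phiK).
by rewrite rmorphM psiK.
Qed.

Lemma irreducible_cancel a : irreducible_elt a -> irreducible_elt (phi a).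
Proof.
have phi_inj := can_inj phiK.
have unitE x : (phi x \is a GRing.unit) = (x \is a GRing.unit).
  apply/idP/idP => [/unitrP[y [yx xy]]|]; last exact: rmorph_unit.
  by apply/unitrP; exists (psi y); split; apply: phi_inj;
    rewrite rmorphM psiK rmorph1.
case=> a0 aNU aI; split; rewrite ?unitE //.
  by rewrite -(inj_eq phi_inj) rmorph0 in a0.
move=> b c; rewrite -[b]psiK -[c]psiK -rmorphM !unitE => /phi_inj.
exact: aI.
Qed.

Lemma irreducible_prime_cancel :
  (forall b : B, irreducible_elt b -> prime_elt b) ->
  forall a : A, irreducible_elt a -> prime_elt a.
Proof.
move=> primeB a aI; have [_ _ aP] := primeB _ (irreducible_cancel aI).
case: aI => a0 aNU _; split=> // b c [d E].
have [||] := aP (phi b) (phi c).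
- by exists (phi d); rewrite -!rmorphM E.
- by move/divides_cancel; left.
- by move/divides_cancel; right.
Qed.

End Transfer.

(** * Factoriality of K[x_1, ..., x_n] *)

Section MPolyFactorial.
Variable K : fieldType.

Lemma mpoly_unit_msize n (p : {mpoly K[n]}) :
  (p \is a GRing.unit) = (msize p == 1%N).
Proof.
apply/idP/idP => [/andP[/eqP pE c0]|/msize_poly1P[c c0 ->]].
  by apply/msize_poly1P; exists p@_0; rewrite // -unitfE.
by rewrite rmorph_unit // unitfE.
Qed.

(** Induction on [msize]: over a field, a nonzero non-unit has [msize] at least 2, so both factors
    of a proper factorization are smaller. *)
Lemma irreducible_prime_product n :
  (forall p : {mpoly K[n]}, irreducible_elt p -> prime_elt p) ->
  forall p : {mpoly K[n]}, p != 0 -> prime_product p.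
Proof.
move=> primeI p; have [m] := ubnP (msize p); elim: m p => // m IHm p.
rewrite ltnS => szp p0; have [pU|pNU] := boolP (p \is a GRing.unit).
  exact: prime_product_unit.
have [/primeI/prime_product_prime //|pNI] := EM (irreducible_elt p).
have [a [b [pE aNU bNU]]] : exists a b,
    [/\ p = a * b, a \isn't a GRing.unit & b \isn't a GRing.unit].
  apply: contrapT => H; apply: pNI; split=> // a b pE.
  have [|aNU] := boolP (a \is a GRing.unit); first by left.
  have [|bNU] := boolP (b \is a GRing.unit); first by right.
  by case: H; exists a, b.
move: p0 szp; rewrite pE mulf_eq0 negb_or => /andP[a0 b0].
rewrite msizeM //; rewrite !mpoly_unit_msize in aNU bNU.
rewrite -!msize_poly_eq0 in a0 b0.
move=> szab; apply: prime_product_mul; apply: IHm; rewrite -?msize_poly_eq0 //;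
  move: (msize a) (msize b) a0 b0 aNU bNU szab => i j; lia.
Qed.

Lemma mpoly0_prime_product (p : {mpoly K[0]}) : p != 0 -> prime_product p.
Proof.
have mE (m : 'X_{1..0}) : m = 0%MM by apply/mnmP; case.
move=> p0; apply: prime_product_unit; rewrite mpoly_unit_msize.
apply/msize_poly1P; exists p@_0; last first.
  by apply/mpolyP => m; rewrite mcoeffC (mE m) eqxx mulr1.
by apply: contraNneq p0 => p00; apply/eqP/mpolyP => m; rewrite mcoeff0 (mE m).
Qed.

(** The inverse of [muni]; together they identify K[x_1, ..., x_(n+1)] with K[x_1, ..., x_n][X]. *)
Definition multi n (P : {poly {mpoly K[n]}}) : {mpoly K[n.+1]} :=
  (map_poly (@mwiden n K) P).['X_ord_max].

Lemma muni_mwiden n (p : {mpoly K[n]}) : muni (mwiden p) = p%:P.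
Proof.
elim/mpolyind: p => [|c m p _ _ IHp]; first by rewrite mwiden0 muni0.
rewrite mwidenD muniD polyCD IHp; congr (_ + _).
rewrite mwidenZ muniZ mwidenX muniE msuppX big_seq1 mcoeffX eqxx scale1r.
rewrite mnmwiden_ordmax expr0 alg_polyC -mul_polyC -polyCM mul_mpolyC.
congr ((_ *: 'X_[_])%:P); apply/mnmP => i; rewrite mnmE.
exact: mnmwiden_widen.
Qed.

Lemma muniXmax n : muni ('X_ord_max : {mpoly K[n.+1]}) = 'X.
Proof.
rewrite muniE msuppX big_seq1 mcoeffX eqxx scale1r mnm1E eqxx expr1.
rewrite -[RHS]scale1r -mpolyX0; congr ('X_[_] *: 'X).
apply/mnmP => i; rewrite !mnmE; apply/eqP; rewrite eqb0; apply/eqP.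
by move/(congr1 val) => /= E; have := ltn_ord i; rewrite -E ltnn.
Qed.

Lemma multiK n : cancel (@multi n) (@muni n K).
Proof.
move=> P; rewrite /multi horner_coef size_map_inj_poly ?mwiden0 //; last first.
  exact: inj_mwiden.
rewrite rmorph_sum -[RHS]coefK poly_def /=; apply: eq_bigr => i _.
by rewrite coef_map /= rmorphM rmorphXn /= muniXmax muni_mwiden mul_polyC.
Qed.

Lemma muniK n : cancel (@muni n K) (@multi n).
Proof.
move=> p; rewrite muniE /multi rmorph_sum horner_sum [RHS]mpolyE.
apply: eq_bigr => m _.
rewrite /= map_polyZ map_polyXn hornerZ hornerXn /= mwidenZ mwidenX -scalerAl.
rewrite mpolyXn -mpolyXD; congr (_ *: 'X_[_]); apply/mnmP => i.
rewrite mnmDE mulmnE mnm1E; have [<-|i_max] := eqVneq ord_max i.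
  by rewrite mnmwiden_ordmax mul1n add0n.
have lti : (i < n)%N by rewrite ltn_neqAle -ltnS ltn_ord andbT eq_sym.
have -> : i = widen_ord (leqnSn n) (Ordinal lti) by apply: val_inj.
by rewrite mnmwiden_widen mnmE mul0n addn0.
Qed.

(** Induction on the number of variables: factorizations of the coefficients make irreducibles prime
    in K[x_1, ..., x_n][X], and [muni] carries this over to one more variable. *)
Lemma mpoly_prime_product n (p : {mpoly K[n]}) : p != 0 -> prime_product p.
Proof.
elim: n p => [|n IHn]; first exact: mpoly0_prime_product.
apply: irreducible_prime_product.
apply: (irreducible_prime_cancel (@muniK n) (@multiK n)).
exact: irreducible_prime_poly.
Qed.

End MPolyFactorial.

(** * Generated subfields *)

Section SubfieldClosure.
Variables (L : fieldType) (F : set L).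
Hypothesis Fsub : is_subfield F.

Lemma subfield1 : F 1.
Proof. by case: Fsub; rewrite inE. Qed.

Lemma subfieldB x y : F x -> F y -> F (x - y).
Proof. by case: Fsub => _ FB _; have := FB x y; rewrite !inE. Qed.

Lemma subfield_div x y : F x -> F y -> F (x / y).
Proof. by case: Fsub => _ _ FV; have := FV x y; rewrite !inE. Qed.

Lemma subfield0 : F 0.
Proof. by rewrite -(subrr 1); apply: subfieldB; apply: subfield1. Qed.

Lemma subfieldD x y : F x -> F y -> F (x + y).
Proof.
move=> Fx Fy; rewrite -[y]opprK -[- y]add0r.
by apply: subfieldB => //; apply: subfieldB => //; apply: subfield0.
Qed.

Lemma subfieldM x y : F x -> F y -> F (x * y).
Proof.
move=> Fx Fy; rewrite -[y]invrK -[y^-1]mul1r.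
by apply: subfield_div => //; apply: subfield_div => //; apply: subfield1.
Qed.

End SubfieldClosure.

Section Subfields.
Variables (L : fieldType) (E S : set L).

Lemma adjoin_min (F : set L) :
  is_subfield F -> E `<=` F -> S `<=` F -> adjoin E S `<=` F.
Proof.
by move=> Fsub EF SF; apply: smallest_sub => // x []; [apply: EF|apply: SF].
Qed.

Lemma sub_adjoin : E `|` S `<=` adjoin E S.
Proof. exact: sub_gen_smallest. Qed.

Lemma adjoin_subfield : is_subfield (adjoin E S).
Proof.
split=> [|x y|x y]; rewrite !inE; first by move=> F [Fsub _]; apply: subfield1.
  by move=> Ax Ay F FP; apply: subfieldB (Ax F FP) (Ay F FP); case: FP.
by move=> Ax Ay F FP; apply: subfield_div (Ax F FP) (Ay F FP); case: FP.
Qed.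

End Subfields.

(** * The pencil spanned by p and q *)

Section Pencil.
Variables (K : fieldType) (n : nat) (p q : {mpoly K[n]}).
Implicit Types (f g : {poly K}) (m k : nat).

(* The value at (p, q) of the degree m homogenization of g; the coefficients of
   g beyond degree m are dropped. *)
Definition homogenized m g : {mpoly K[n]} :=
  \sum_(i < m.+1) g`_i *: (p ^+ i * q ^+ (m - i)).

Definition frac_const (c : K) : {fraction {mpoly K[n]}} := (c%:MP_[n])%:F.

HB.instance Definition _ := GRing.RMorphism.copy frac_const
  (@FracField.tofrac {mpoly K[n]} \o @mpolyC n K).

Definition quotient_eval g : {fraction {mpoly K[n]}} :=
  (map_poly frac_const g).[p%:F / q%:F].

HB.instance Definition _ := GRing.RMorphism.copy quotient_eval
  (horner_eval (p%:F / q%:F) \o map_poly frac_const).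

Lemma quotient_evalC c : quotient_eval c%:P = frac_const c.
Proof. by rewrite /quotient_eval map_polyC hornerC. Qed.

Lemma quotient_evalX : quotient_eval 'X = p%:F / q%:F.
Proof. by rewrite /quotient_eval map_polyX hornerX. Qed.

(** * Top coefficients of forms in p and q *)

Lemma mlead_exp_le (r : {mpoly K[n]}) (M : 'X_{1..n}) k :
  (mlead r <= M)%O -> (mlead (r ^+ k) <= (M *+ k)%MM)%O.
Proof.
move=> rM; apply: le_trans (mleadX_le _ _) _.
by elim: k => [|j IHj]; rewrite ?mulmS ?mulm0n //; apply: lem_add.
Qed.

Lemma mcoeff_exp_top (r : {mpoly K[n]}) (M : 'X_{1..n}) k :
  (mlead r <= M)%O -> (r ^+ k)@_(M *+ k)%MM = r@_M ^+ k.
Proof.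
move=> rM; elim: k => [|k IHk]; first by rewrite mcoeff1 eqxx.
by rewrite !exprS mulmS mleadcMW ?IHk // mlead_exp_le.
Qed.

(** Coefficients at an upper bound of the leading monomials are multiplicative, and every p^i
    q^(m-i) has m factors. As [M] is only a bound, [p@_M] or [q@_M] may be zero. *)
Lemma mcoeff_homogenized_top (M : 'X_{1..n}) m g :
  (mlead p <= M)%O -> (mlead q <= M)%O ->
  (homogenized m g)@_(M *+ m)%MM =
    \sum_(i < m.+1) g`_i * (p@_M ^+ i * q@_M ^+ (m - i)).
Proof.
move=> pM qM; rewrite raddf_sum /=; apply: eq_bigr => i _; rewrite mcoeffZ.
have -> : (M *+ m = M *+ i + M *+ (m - i))%MM.
  by apply/mnmP => j; rewrite mnmDE !mulmnE -mulnDr subnKC // -ltnS.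
by rewrite mleadcMW ?mlead_exp_le // !mcoeff_exp_top.
Qed.

(** * Coprimality of p and q, and transcendence of p/q *)

Hypotheses (hnc : ~ (is_constant p /\ is_constant q)) (hgcd : is_gcd 1 p q).

Lemma common_divisor_unit (d : {mpoly K[n]}) :
  divides d p -> divides d q -> d \is a GRing.unit.
Proof.
by case: hgcd => _ _ /[apply] /[apply]; apply: divides_unit; apply: unitr1.
Qed.

Lemma unit_constant (r : {mpoly K[n]}) : r \is a GRing.unit -> is_constant r.
Proof. by rewrite mpoly_unit_msize => /msize_poly1P[c _ ->]; exists c. Qed.

Lemma denominator_neq0 : q != 0.
Proof.
apply/eqP => q0; apply: hnc; split; last by exists 0; rewrite q0 mpolyC0.
apply/unit_constant/common_divisor_unit; first by exists 1; rewrite mulr1.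
by exists 0; rewrite q0 mulr0.
Qed.

(** Otherwise [q] would be a common divisor, hence a unit, and both polynomials would be
    constant. *)
Lemma numerator_neq_scale (c : K) : p != c *: q.
Proof.
apply/eqP => pE; have qU : q \is a GRing.unit.
  by apply: common_divisor_unit; [exists c%:MP | exists 1];
    rewrite ?mulr1 // pE mulrC mul_mpolyC.
have [d qE] := unit_constant qU; apply: hnc; split; last by exists d.
by exists (c * d); rewrite pE qE mpolyCM mul_mpolyC.
Qed.

Let q0 : q%:F != 0.
Proof. by rewrite tofrac_eq0 denominator_neq0. Qed.

Lemma homogenizedE m g : (size g <= m.+1)%N ->
  (homogenized m g)%:F = quotient_eval g * q%:F ^+ m.
Proof.
move=> szg; rewrite /quotient_eval (@horner_coef_wide _ m.+1); last first.
  exact: leq_trans (size_poly _ _) szg.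
rewrite raddf_sum mulr_suml /=; apply: eq_bigr => i _.
rewrite coef_map /= -mul_mpolyC !rmorphM !rmorphXn /= -mulrA; congr (_ * _).
rewrite expr_div_n -mulrA; congr (_ * _).
have qi0 := expf_neq0 i q0.
by apply: (mulfI qi0); rewrite mulVKf // -exprD subnKC // -ltnS.
Qed.

Let M : 'X_{1..n} := if (mlead p <= mlead q)%O then mlead q else mlead p.

Let pM : (mlead p <= M)%O.
Proof. by rewrite /M; case: ifP. Qed.

Let qM : (mlead q <= M)%O.
Proof.
by rewrite /M; case: (leP (mlead p) (mlead q)) => [_|/ltW]; rewrite ?lexx.
Qed.

Let top_neq0 : (p@_M != 0) || (q@_M != 0).
Proof.
have p0 : p != 0 by rewrite -(scale0r q) numerator_neq_scale.
by rewrite /M; case: ifP => _; rewrite mleadc_eq0 ?denominator_neq0 ?orbT ?p0.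
Qed.

Let M_neq0 : M != 0%MM.
Proof.
apply/eqP => M0; apply: hnc.
have constE (r : {mpoly K[n]}) : (mlead r <= M)%O -> is_constant r.
  move=> rM; exists r@_0; apply: msize1_polyC.
  have [->|r0] := eqVneq r 0; first by rewrite msize0.
  rewrite -mlead_deg // ltnS leqn0 mdeg_eq0.
  by rewrite -lex0; move: rM; rewrite M0.
by split; apply: constE.
Qed.

(* The coefficients [p@_M], [q@_M] at the largest monomial of the pair produce
   the root of g. *)
Lemma homogenized_top_root m g : (size g <= m.+1)%N ->
  (homogenized m g)@_(M *+ m)%MM = 0 ->
  (q@_M = 0 /\ g`_m = 0) \/ exists c, root g c.
Proof.
move=> szg; rewrite mcoeff_homogenized_top //.
have [qM0|qM0] := eqVneq q@_M 0 => E; [left|right].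
  split=> //; move: top_neq0 E; rewrite qM0 eqxx orbF => pM0.
  (* Only the term [i = m] survives, because [0 ^+ (m - i)] vanishes for [i < m]. *)
  rewrite big_ord_recr /= big1 ?add0r ?subnn; last first.
    by move=> i _; rewrite expr0n subn_eq0 leqNgt ltn_ord !mulr0.
  by move/eqP; rewrite mulr1 mulf_eq0 (negPf (expf_neq0 _ pM0)) orbF => /eqP.
(* Dehomogenize: dividing the vanishing form by [q@_M ^+ m] gives the value of [g] at this ratio. *)
exists (p@_M / q@_M); apply/eqP/(mulIf (expf_neq0 m qM0)).
rewrite mul0r -[RHS]E (horner_coef_wide _ szg) mulr_suml.
apply: eq_bigr => i _; rewrite -mulrA; congr (_ * _).
rewrite expr_div_n -mulrA; congr (_ * _).
have qi0 := expf_neq0 i qM0.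
by apply: (mulfI qi0); rewrite mulVKf // -exprD subnKC // -ltnS.
Qed.

(** Since p/q - c = (p - c q)/q, each root of [g] in K contributes a member of the pencil. *)
Lemma quotient_eval_factor g c :
  quotient_eval (g * ('X - c%:P)) = quotient_eval g * (p - c *: q)%:F / q%:F.
Proof.
rewrite rmorphM -mulrA; congr (_ * _).
rewrite rmorphB /= quotient_evalX quotient_evalC rmorphB mulrBl /=.
by rewrite -mul_mpolyC rmorphM mulfK.
Qed.

(** Transcendence of p/q, by descent on the degree: a relation [g] yields a zero form, hence a root
    c of [g] in K; as p - c q is nonzero, the cofactor of the root is again a relation. *)
Lemma quotient_eval_eq0 g : (quotient_eval g == 0) = (g == 0).
Proof.
apply/idP/eqP => [|->]; last by rewrite rmorph0.
have [m] := ubnP (size g); elim: m g => // m IHm g; rewrite ltnS => szg.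
move=> /eqP eg0; have [//|g0] := eqVneq g 0.
(* The form is taken in the exact degree of [g], so that in the case [q@_M = 0] the vanishing
   coefficient is the leading one. *)
have szgS : (size g <= (size g).-1.+1)%N by exact: leqSpred.
have := homogenized_top_root szgS.
case.
- suff -> : homogenized (size g).-1 g = 0 by rewrite mcoeff0.
  by apply/eqP; rewrite -tofrac_eq0 homogenizedE // eg0 mul0r.
- by case=> _ /eqP; rewrite -[_`__]/(lead_coef g) lead_coef_eq0 => /eqP.
case=> c /factor_theorem[h gE]; move/eqP: eg0.
rewrite gE quotient_eval_factor mulf_eq0 invr_eq0 (negPf q0) orbF mulf_eq0.
rewrite tofrac_eq0 subr_eq0 (negPf (numerator_neq_scale c)) orbF.
move/(IHm h) => -> //; first by rewrite mul0r.
have h0 : h != 0 by apply: contraNneq g0 => h0; rewrite gE h0 mul0r.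
by rewrite (leq_trans _ szg) // gE size_Mmonic ?monicXsubC // size_XsubC addn2.
Qed.

(** * The field K(p/q) and the implication (1) => (2) *)

Local Notation Kx0 := (constants K n).
Local Notation Kpq := (adjoin Kx0 [set p%:F / q%:F]).

Lemma adjoin_quotient_eval g : Kpq (quotient_eval g).
Proof.
have Fsub : is_subfield Kpq by exact: adjoin_subfield.
elim/poly_ind: g => [|g c IHg].
  by rewrite rmorph0; apply: subfield0.
rewrite rmorphD rmorphM /= quotient_evalX quotient_evalC.
apply: (subfieldD Fsub) => //; last by apply: sub_adjoin; left; exists c.
by apply: (subfieldM Fsub) => //; apply: sub_adjoin; right.
Qed.

(** The fractions f(t)/g(t) form a subfield containing K and t = p/q; transcendence of t keeps the
    denominators nonzero. *)
Lemma adjoin_quotientP x : Kpq x ->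
  exists f g, g != 0 /\ x = quotient_eval f / quotient_eval g.
Proof.
pose F := [set x | exists f g, g != 0 /\ x = quotient_eval f / quotient_eval g].
suff : Kpq `<=` F by apply.
apply: adjoin_min => [|_ [c _ <-]|_ ->]; last first.
- by exists 'X, 1; rewrite oner_neq0 rmorph1 divr1 quotient_evalX.
- by exists c%:P, 1; rewrite oner_neq0 rmorph1 divr1 quotient_evalC.
split=> [|x1 x2|x1 x2]; rewrite !inE.
- by exists 1, 1; rewrite oner_neq0 rmorph1 divr1.
- move=> [f [g [g0 ->]]] [h [k [k0 ->]]]; exists (f * k - h * g), (g * k).
  rewrite mulf_neq0 // rmorphB !rmorphM /= -[- (_ / _)]mulNr.
  rewrite addf_div ?quotient_eval_eq0 //.
  by rewrite mulNr.
move=> [f [g [g0 ->]]] [h [k [k0 ->]]].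
(* Division by zero gives zero, which is the fraction 0/1. *)
have [->|h0] := eqVneq h 0.
  by exists 0, 1; rewrite oner_neq0 rmorph0 !mul0r invr0 mulr0.
exists (f * k), (g * h); rewrite mulf_neq0 // !rmorphM /= invf_div.
by rewrite mulf_div.
Qed.

(* A relation F(p, q) = 0 reads F(tY, Y) = 0 at Y = q with t = p/q; the
   coefficient of Y^d is the degree d part of F evaluated at (t, 1), and t is
   transcendental over K. *)
Lemma denominator_algebraic : alg_dependent p q -> algebraic_over Kpq q%:F.
Proof.
case=> F [F0 Fpq].
(* At (tY, Y) the monomial with exponents i, j becomes t^i Y^(i+j); [mono] keeps its t-part. *)
pose mono (m : 'X_{1..2}) := F@_m *: 'X^(m ord0).
pose G := \sum_(m <- msupp F) quotient_eval (mono m) *: 'X^(mdeg m).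
have mdeg2 (m : 'X_{1..2}) : mdeg m = (m ord0 + m ord_max)%N.
  by rewrite mdegE big_ord_recr big_ord1; congr (m _ + _)%N; apply: val_inj.
have coefG d :
    G`_d = quotient_eval (\sum_(m <- msupp F) mono m *+ (d == mdeg m)).
  rewrite rmorph_sum coef_sum; apply: eq_bigr => m _.
  by rewrite rmorphMn /= coefZ coefXn mulr_natr.
exists G; split.
(* A monomial in two variables is determined by its total degree and first exponent, so the leading
   term of [F] cannot cancel in [G]. *)
- apply/eqP => G0; have mF := mlead_supp F0; set m1 := mlead F in mF.
  have : quotient_eval (\sum_(m <- msupp F) mono m *+ (mdeg m1 == mdeg m)) = 0.
    by rewrite -coefG G0 coef0.
  move/eqP; rewrite quotient_eval_eq0 => /eqP/(congr1 (coefp (m1 ord0))) /=.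
  rewrite coef0 coef_sum (bigD1_seq m1) ?msupp_uniq //= eqxx mulr1n.
  rewrite coefZ coefXn eqxx mulr1 big1 ?addr0 => [/eqP|m mm1].
    by rewrite mleadc_eq0 (negPf F0).
  rewrite coefMn coefZ coefXn; have [E0|] := eqVneq (m1 ord0) (m ord0); last first.
    by rewrite mulr0 mul0rn.
  have [E1|//] := eqVneq (mdeg m1) (mdeg m).
  case/eqP: mm1; apply/mnmP => i.
  have : m ord_max = m1 ord_max.
    by move: E1; rewrite !mdeg2 E0 => /addnI.
  case: (unliftP ord_max i) => [j ->|-> //] _.
  by have -> : lift ord_max j = ord0 by apply: val_inj; case: j => -[].
- by apply/(all_nthP 0) => d _; rewrite coefG inE; apply: adjoin_quotient_eval.
suff E : G.[q%:F] = (F \mPo [tuple p; q])%:F by rewrite /root E Fpq rmorph0.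
rewrite comp_mpolyE horner_sum rmorph_sum; apply: eq_bigr => m _.
rewrite hornerZ hornerXn -mul_mpolyC rmorphM /=.
rewrite /mono -mul_polyC rmorphM rmorphXn /= quotient_evalC quotient_evalX.
rewrite -mulrA; congr (_ * _).
rewrite big_ord_recr big_ord1 mdeg2 exprD mulrA -exprMn divfK //.
by rewrite rmorphM !rmorphXn /=; congr (_ ^+ m _ * _); apply: val_inj.
Qed.

(** Closedness puts the algebraic element q, and then p = (p/q) q, in K(p/q); if its only
    polynomials were constants, both would be constant. *)
Lemma alg_closed_polynomials :
  alg_dependent p q -> alg_closed_in Kpq -> Kpq `&` polynomials K n <> Kx0.
Proof.
move=> pq_dep pq_closed E; apply: hnc.
have qK : Kpq q%:F by apply: pq_closed; apply: denominator_algebraic.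
have pK : Kpq p%:F.
  suff : Kpq (p%:F / q%:F * q%:F) by rewrite divfK.
  apply: (subfieldM (@adjoin_subfield _ _ _)) => //.
  by apply: sub_adjoin; right.
suff constE r : Kpq r%:F -> is_constant r by split; apply: constE.
move=> rK; have : Kx0 r%:F by rewrite -E; split=> //; exists r.
by case=> c _ /eqP; rewrite tofrac_eq => /eqP <-; exists c.
Qed.

(** * Nonconstant polynomials in K(p/q): the implication (2) => (3) *)

Lemma dvd_homogenized (a : {mpoly K[n]}) m g : divides a q ->
  divides a (homogenized m g) -> divides a (g`_m *: p ^+ m).
Proof.
move=> aq; rewrite /homogenized big_ord_recr /= subnn mulr1 => aH.
(* Every term with [i < m] contains a factor q, so modulo [a] only the top term remains. *)
rewrite -[_ *: _](addKr (\sum_(i < m) g`_i *: (p ^+ i * q ^+ (m - i)))).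
rewrite addrC; apply: divides_sub => //; apply: divides_sum => i _.
rewrite -mul_mpolyC; do 2!apply: divides_mull.
by rewrite -(subnSK (ltn_ord i)) exprS; apply: divides_mulr.
Qed.

(* Bezout: u f + v g = 1 makes a power of q a combination of the
   homogenizations of f and g; a prime dividing both then divides q, and hence
   p through a leading coefficient. *)
Lemma homogenized_coprime (a : {mpoly K[n]}) m f g :
  coprimep f g -> (size f <= m.+1)%N -> (size g <= m.+1)%N ->
  f`_m != 0 \/ g`_m != 0 ->
  divides a (homogenized m f) -> divides a (homogenized m g) -> ~ prime_elt a.
Proof.
move=> /Bezout_eq1_coprimepP[[u v] /= uv1] szf szg lead0 af ag aP.
have aq : divides a q.
  (* A common degree bound for [u] and [v]: in degree [k + m] the relation u f + v g = 1 homogenizes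
     to q^(k+m). *)
  pose k := maxn (size u) (size v).
  apply: (prime_dividesX (k := k + m) aP).
  suff -> : q ^+ (k + m) =
      homogenized k u * homogenized m f + homogenized k v * homogenized m g.
    by apply: divides_add; apply: divides_mull.
  apply/eqP; rewrite -tofrac_eq rmorphD !rmorphM rmorphXn /=.
  have szu : (size u <= k.+1)%N by rewrite leqW // leq_maxl.
  have szv : (size v <= k.+1)%N by rewrite leqW // leq_maxr.
  rewrite !homogenizedE //.
  rewrite (mulrACA (quotient_eval u)) (mulrACA (quotient_eval v)) -mulrDl.
  by rewrite -!rmorphM -rmorphD uv1 rmorph1 mul1r -exprD.
have apm (c : K) : c != 0 -> divides a (c *: p ^+ m) -> False.
  move=> c0; rewrite -mul_mpolyC => /divides_mulUr.
  rewrite rmorph_unit ?unitfE // => /(_ isT)/(prime_dividesX aP) ap.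
  by case: aP => _ /negP aNU _; apply/aNU/common_divisor_unit.
by case: lead0 => [/apm|/apm]; apply; apply: dvd_homogenized.
Qed.

Lemma polynomial_in_adjoin :
  Kpq `&` polynomials K n <> Kx0 -> exists l m : K, l *: p + m *: q = 1.
Proof.
move=> neqK.
(* K always lies in the intersection, so inequality means a nonconstant polynomial there. *)
have [r [rK rNc]] : exists r : {mpoly K[n]}, Kpq r%:F /\ ~ is_constant r.
  apply: contrapT => H; apply: neqK; apply/seteqP.
  split=> [x [xK [r _ rx]]|x x0].
    apply: contrapT => xNc; apply: H; exists r; rewrite rx.
    by split=> // -[c rE]; apply: xNc; exists c; rewrite -?rx ?rE.
  split; first by apply: sub_adjoin; left.
  by case: x0 => c _ <-; exists c%:MP.
have [f [g [cop g0 rE]]] : exists f g,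
    [/\ coprimep f g, g != 0 & r%:F * quotient_eval g = quotient_eval f].
  have [f [g [g0 rE]]] := adjoin_quotientP rK.
  exists (f %/ gcdp f g), (g %/ gcdp f g).
  have d0 : gcdp f g != 0 by rewrite gcdp_eq0 negb_and g0 orbT.
  rewrite coprimep_div_gcd ?g0 ?orbT // dvdp_div_eq0 ?dvdp_gcdr //.
  split=> //; apply/(mulIf (_ : quotient_eval (gcdp f g) != 0)).
    by rewrite quotient_eval_eq0.
  rewrite -mulrA -!rmorphM !divpK ?dvdp_gcdl ?dvdp_gcdr //.
  by rewrite rE divfK ?quotient_eval_eq0.
have f0 : f != 0.
  apply/eqP => f0; apply: rNc; exists 0; apply/eqP.
  move/eqP: rE; rewrite f0 rmorph0 mulf_eq0 quotient_eval_eq0 (negPf g0) orbF.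
  by rewrite tofrac_eq0 mpolyC0.
(* The larger of the two degrees: both forms fit, and [f] or [g] has a nonzero coefficient at
   [m]. *)
pose m := (maxn (size f) (size g)).-1.
have mE : m.+1 = maxn (size f) (size g).
  by rewrite prednK // leq_max lt0n size_poly_eq0 f0.
have szf : (size f <= m.+1)%N by rewrite mE leq_maxl.
have szg : (size g <= m.+1)%N by rewrite mE leq_maxr.
have lead0 : f`_m != 0 \/ g`_m != 0.
  rewrite /m; case: (leqP (size f) (size g)) => _.
    by right; rewrite -[_`__]/(lead_coef g) lead_coef_eq0.
  by left; rewrite -[_`__]/(lead_coef f) lead_coef_eq0.
(* If [m] were 0, then [f] and [g], and hence [r], would be constant. *)
have m_gt0 : (0 < m)%N.
  rewrite lt0n; apply/eqP => m0; rewrite m0 in szf szg.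
  have fC := size1_polyC szf; have gC := size1_polyC szg.
  have g00 : g`_0 != 0 by rewrite -polyC_eq0 -gC.
  have rcE : r * (g`_0)%:MP = (f`_0)%:MP.
    apply/eqP; rewrite -tofrac_eq rmorphM /=; apply/eqP.
    by rewrite -[LHS]/(r%:F * frac_const g`_0) -quotient_evalC -gC rE
               [in LHS]fC quotient_evalC.
  have gMP0 : (g`_0)%:MP_[n] != 0 by rewrite mpolyC_eq0.
  apply: rNc; exists (f`_0 / g`_0); apply: (mulIf gMP0).
  by rewrite rcE -mpolyCM divfK.
set D := homogenized m g.
have fE : homogenized m f = r * D.
  by apply/eqP; rewrite -tofrac_eq rmorphM /= /D !homogenizedE // -rE mulrA.
have D0 : D != 0.
  by rewrite -tofrac_eq0 /D homogenizedE // mulf_neq0 ?expf_neq0 ?quotient_eval_eq0.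
(* A prime factor of [D] would also divide [r * D], the form of [f], against
   [homogenized_coprime]. *)
have DU : D \is a GRing.unit.
  case: (prime_product_divisor (mpoly_prime_product D0)) => // -[a aP aD].
  case: (homogenized_coprime cop szf szg lead0 _ aD aP).
  by rewrite fE; apply: divides_mull.
(* [D] is constant, whereas [M *+ m] is a nontrivial monomial because [m] is positive. *)
have DM0 : D@_(M *+ m)%MM = 0.
  have [d ->] := unit_constant DU; rewrite mcoeffC.
  suff /negPf-> : (M *+ m)%MM != 0%MM by rewrite mulr0.
  by rewrite -mdeg_eq0 mdegMn muln_eq0 mdeg_eq0 negb_or M_neq0 -lt0n.
have linear_unit (l k : K) :
    l *: p + k *: q \is a GRing.unit -> exists l m : K, l *: p + m *: q = 1.
  move=> U; have [d E] := unit_constant U; exists (d^-1 * l), (d^-1 * k).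
  have d0 : d != 0.
    by move: U; rewrite E; apply: contraTneq => ->; rewrite mpolyC0 unitr0.
  by rewrite -!scalerA -scalerDr E -mul_mpolyC -mpolyCM mulVf.
have [[_ gm0]|[c /factor_theorem[h gE]]] := homogenized_top_root szg DM0.
  (* With the coefficient of [g] at [m] zero, every term of [D] contains q, so q is itself a
     unit. *)
  apply: (linear_unit 0 1); rewrite scale0r scale1r add0r.
  apply: divides_unit DU _; rewrite /D /homogenized big_ord_recr /= gm0 scale0r addr0.
  apply: divides_sum => i _; rewrite -mul_mpolyC; do 2!apply: divides_mull.
  by rewrite -(subnSK (ltn_ord i)) exprS; exists (q ^+ (m - i.+1)).
(* The root c makes p - c q a divisor of the unit [D], with cofactor the form of [h] in degree m -
   1. *)
apply: (linear_unit 1 (- c)); rewrite scale1r scaleNr.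
apply: divides_unit DU _; exists (homogenized m.-1 h).
have h0 : h != 0 by apply: contraNneq g0 => h0; rewrite gE h0 mul0r.
have szh : (size h <= m.-1.+1)%N.
  by rewrite prednK // -ltnS (leq_trans _ szg) // gE size_Mmonic ?monicXsubC //
             size_XsubC addn2.
apply/eqP; rewrite -tofrac_eq rmorphM /= !homogenizedE // gE quotient_eval_factor.
rewrite -{1}(prednK m_gt0) exprS mulrA divfK //.
by rewrite (mulrC (quotient_eval h)) -mulrA.
Qed.

(** Dividing l p + m q = 1 by q gives 1/q = l (p/q) + m, so K(p/q) contains q and then p = (p/q)
    q. *)
Lemma adjoin_quotient_eq :
  (exists l m : K, l *: p + m *: q = 1) -> Kpq = adjoin Kx0 [set p%:F; q%:F].
Proof.
case=> l [m lm1]; have Fsub := @adjoin_subfield _ Kx0 [set p%:F / q%:F].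
have Gsub := @adjoin_subfield _ Kx0 [set p%:F; q%:F].
apply/seteqP; split; apply: adjoin_min => //.
- by move=> x x0; apply: sub_adjoin; left.
- by move=> _ ->; apply: (subfield_div Gsub); apply: sub_adjoin; right; [left|right].
- by move=> x x0; apply: sub_adjoin; left.
have tK : Kpq (p%:F / q%:F) by apply: sub_adjoin; right.
have E : frac_const l * p%:F + frac_const m * q%:F = 1.
  have := congr1 (@FracField.tofrac {mpoly K[n]}) lm1.
  by rewrite -!mul_mpolyC rmorphD !rmorphM rmorph1.
have qE : 1 / quotient_eval (l *: 'X + m%:P) = q%:F.
  rewrite -mul_polyC rmorphD rmorphM /= !quotient_evalC quotient_evalX.
  rewrite -(mulfK q0 (frac_const m)) mulrA -mulrDl.
    by rewrite E invf_div divr1 mul1r.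
have qK : Kpq q%:F.
  suff : Kpq (1 / quotient_eval (l *: 'X + m%:P)) by rewrite qE.
  apply: (subfield_div Fsub); first exact: subfield1.
  exact: adjoin_quotient_eval.
move=> _ [->|->] //; suff : Kpq (p%:F / q%:F * q%:F) by rewrite divfK.
exact: (subfieldM Fsub).
Qed.

End Pencil.

Theorem theorem3p1 (K : fieldType) (n : nat) (p q : {mpoly K[n]})
    (hnc : ~ (is_constant p /\ is_constant q)) (hgcd : is_gcd 1 p q) :
  let Kx0 := constants K n in
  let Kpq := adjoin Kx0 [set p%:F / q%:F] in
  [/\ alg_dependent p q /\ alg_closed_in Kpq ->
        Kpq `&` polynomials K n <> Kx0,
      Kpq `&` polynomials K n <> Kx0 ->
        exists l m : K, l *: p + m *: q = 1
    & (exists l m : K, l *: p + m *: q = 1) ->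
        Kpq = adjoin Kx0 [set p%:F; q%:F]].
Proof.
move=> Kx0 Kpq; split.
- by case=> pq_dep pq_closed; apply: alg_closed_polynomials.
- exact: polynomial_in_adjoin.
exact: adjoin_quotient_eq.
Qed.
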